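(* The smallest elated number of height $15$ is \[\varepsilon_{15}=7489\times 10^{n_{15}}-1,\] where \[n_{15}=\frac{\varepsilon_{14}/7-7^2-144}{9^2}\] and $\varepsilon_{14}$ is the smallest elated number of height $14$. Further, $\varepsilon_{15}$ is the only basic elated number of height $15$ less than $7\times 10^{n_{15}+4}$.
   Context: All digits are base $10$. For $a\in\mathbb{Z}^+$ with decimal expansion $a=\sum_{i=0}^n a_i10^i$, $0\le a_i\le 9$, leading digit $a_n\ne 0$, let $E_2(a)=a_n\sum_{i=0}^n a_i^2$. A positive integer $a$ is elated if $E_2^m(a)=1$ for some $m\ge 0$ (iteration), and its height is the smallest such $m$. $\varepsilon_k$ denotes the smallest elated number of height $k$. A number is basic if it is greater than $10$ and its non-leading decimal digits are nonzero and in nondecreasing order (read from left to right). *)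

(* Defs.v *)
From mathcomp Require Import all_boot all_order all_algebra.

Set Implicit Arguments.
Unset Strict Implicit.
Unset Printing Implicit Defensive.

(* Index of the leading decimal digit of [a] (for [0 < a]): the [n] such that
   [10 ^ n <= a < 10 ^ n.+1]. *)
Definition top (a : nat) : nat := trunc_log 10 a.

Definition digit (a i : nat) : nat := (a %/ 10 ^ i) %% 10.

Definition E2 (a : nat) : nat :=
  digit a (top a) * \sum_(i < (top a).+1) digit a i ^ 2.

Definition elated (a : nat) : Prop := 0 < a /\ exists m, iter m E2 a = 1.

Definition elated_of_height (k a : nat) : bool :=
  [&& 0 < a, iter k E2 a == 1 & [forall m : 'I_k, iter m E2 a != 1]].

(* Digits are indexed by their power of ten, so reading from left to right is
   decreasing index, and the non-leading digits are those of index [< top a]. *)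
Definition basic (a : nat) : Prop :=
  [/\ 10 < a,
      forall i, i < top a -> digit a i <> 0
    & forall i j, i <= j -> j < top a -> digit a j <= digit a i].

Lemma elatedP (a : nat) : elated a <-> exists k, elated_of_height k a.
Proof.
split=> [[a0 [m /eqP hm]] | [k /and3P[a0 /eqP hk _]]]; last by split=> //; exists k.
have ex : exists k, iter k E2 a == 1 by exists m.
case: (ex_minnP ex) => k hk kmin; exists k; apply/and3P; split=> //.
apply/forallP=> i; apply/negP=> /kmin; by rewrite leqNgt ltn_ord.
Qed.

Definition repunit (n : nat) : nat := iter n (fun x => x * 10 + 1) 0.

Lemma repunit_bounds n : 10 ^ n <= repunit n.+1 < 10 ^ n.+1.
Proof.
elim: n => [//|n /andP[lo hi]].
rewrite [repunit n.+2]/= -/(repunit n.+1).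
rewrite [10 ^ n.+1]expnSr [10 ^ n.+2]expnSr.
apply/andP; split; first by rewrite (leq_trans _ (leq_addr _ _)) // leq_mul2r lo.
have: (repunit n.+1).+1 * 10 <= 10 ^ n.+1 * 10 by rewrite leq_mul2r hi.
by apply: leq_trans; rewrite mulSn [10 + _]addnC -addnS leq_add2l.
Qed.

Lemma top_repunit n : top (repunit n.+1) = n.
Proof. by apply: trunc_log_eq => //; apply: repunit_bounds. Qed.

Lemma digit_repunit n i : i < n -> digit (repunit n) i = 1.
Proof.
rewrite /digit; elim: i n => [|i IH] [|n] //= lt_in.
  by rewrite expn0 divn1 -/(repunit n) modnMDl.
by rewrite expnS divnMA -/(repunit n) divnMDl // addn0 IH.
Qed.

Lemma E2_repunit n : E2 (repunit n.+1) = n.+1.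
Proof.
rewrite /E2 top_repunit digit_repunit // mul1n.
under eq_bigr => i _ do rewrite digit_repunit //.
by rewrite sum_nat_const card_ord muln1.
Qed.

Lemma elated_of_height_ex (k : nat) : exists a, elated_of_height k a.
Proof.
suff: k = 0 \/ exists2 a, 1 < a & elated_of_height k a.
  case=> [->|[a _ ha]]; last by exists a.
  by exists 1; apply/and3P; split=> //; apply/forallP=> -[].
case: k => [|k]; [by left | right].
elim: k => [|k [a a1 /and3P[a0 /eqP hk hmin]]].
  have E10 : E2 10 = 1.
    have t10 : top 10 = 1 by apply: trunc_log_eq.
    by rewrite /E2 t10 !big_ord_recr big_ord0.
  exists 10 => //; apply/and3P; split=> //; first by rewrite /= E10.
  by apply/forallP=> -[[]].
case: a a0 a1 hk hmin => // a _ a1 hk /forallP hmin.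
have r1 : 1 < repunit a.+1.
  case: a a1 {hk hmin} => // a _.
  have /andP[lo _] := repunit_bounds a.+1.
  by apply: leq_trans lo; rewrite expnS (leq_trans (isT : 1 < 10)) // leq_pmulr ?expn_gt0.
exists (repunit a.+1) => //; apply/and3P; split; first exact: ltnW.
  by rewrite iterSr E2_repunit hk.
apply/forallP=> -[[|m] lt_m]; first by rewrite /= neq_ltn r1 orbT.
by rewrite [X in iter X _ _]/= iterSr E2_repunit; apply: (hmin (Ordinal (lt_m : m < k.+1))).
Qed.

(* The smallest elated number of height [k]. *)
Definition epsilon (k : nat) : nat := ex_minn (elated_of_height_ex k).

(* Main.v *)
Require Import Defs.
From Stdlib Require Import BinNat.
From mathcomp Require Import all_boot all_order all_algebra.
From mathcomp Require Import zify lra.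

Set Implicit Arguments.
Unset Strict Implicit.
Unset Printing Implicit Defensive.

Import GRing.Theory.

(** The numbers involved are far too large to be written down (the smallest
    elated number of height 13 has about 14 million digits), but they are
    governed by few parameters.  If [a] has leading digit [d] followed by the
    word [s], then [E2 a = d * (d ^ 2 + 81 * size s - deficit s)], where the
    deficit of [s] is the sum of the [81 - x ^ 2] over its digits [x].  A small
    elated number has few digits, so its word must consist almost entirely of
    nines, and its deficit is a small number.  The possible deficits are
    0, 17 (digit 8), 32 (digit 7), 45, 56, 65, 72, 77, 80, 81 and their sums,
    and a given deficit leaves only a few multisets of non-nine digits.

    The proof shows, for the heights [k] = 12, 13 and 14, that the elated numbers
    of height [k] with at most [T + 1] digits all have exactly [T + 1] digits, the
    leading digit 8 and the same deficit [r] ([classified]): [(T, r)] is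
    [(9, 51)], [(top13, 168)] and [(top14, 105)].  It climbs from one height to the
    next as follows.  Let [a] be of height [k + 1], with leading digit [d] and no
    more digits than allowed, and put [c = E2 a], a multiple of [d].
    - The bound on [a] gives [c < 2 * 10 ^ (T + 1)].  If [c] had [T + 2] digits it
      would begin with 1, so that [E2 c] would be smaller than every number of
      height [k - 1].  Hence [c] is in the class of height [k]
      ([image_in_class]), and [c >= 8 * 10 ^ T].
    - [d = 9] would require [c] to be divisible by 9, but the deficit [r] leaves
      few residues modulo 9 for the digit sum of [c], none of them suitable
      ([class_mod9]).
    - [d <= 7] is impossible because [c / d] would exceed what the allowed number
      of digits of [a] can produce.
    - So [d = 8] and [c] is a multiple of 8.  The last three digits of [c]
      and its size then determine [c] ([class_9_51_dvd8], [class_168_dvd8]), hence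
      the sum of the squared digits of [a].  The number of digits of [a] is then
      forced, because the deficits that fewer digits would leave are not sums
      of the numbers listed above ([unreachable]).

    At height 15 the argument changes once: no number of the class of height 14
    is divisible by 8 ([class_105_ndvd8]), so that [d = 7], and the image must be
    the least number of height 14, which is [8578] followed by nines.  This leaves
    the deficit 99, whose digits other than 9 can only be 4, 8, 8.  In
    nondecreasing order they give [7488] followed by nines, which is both the
    least choice and the only basic one.

    The starting point, the six numbers of height 11 up to 7290, is found by
    direct computation ([elated11_small]). *)

(** * Decimal words *)

(** Words are read from left to right, so the head of the list is the leading
    digit. *)
Definition dval (s : seq nat) : nat := foldl (fun v x => 10 * v + x) 0 s.

Definition digits (s : seq nat) : bool := all (fun x => x < 10) s.

Definition sumsq (s : seq nat) : nat := sumn [seq x * x | x <- s].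

Definition deficit (s : seq nat) : nat := sumn [seq 81 - x * x | x <- s].

Lemma dval_rcons s x : dval (rcons s x) = 10 * dval s + x.
Proof. by rewrite /dval foldl_rcons. Qed.

Lemma dval_cat s t : dval (s ++ t) = dval s * 10 ^ size t + dval t.
Proof.
elim/last_ind: t => [|t x IH]; first by rewrite cats0 muln1 addn0.
rewrite -rcons_cat !dval_rcons IH size_rcons expnS; lia.
Qed.

Lemma dval_cons x s : dval (x :: s) = x * 10 ^ size s + dval s.
Proof. by rewrite -cat1s dval_cat /dval /= muln0 add0n. Qed.

Lemma dval_lt s : digits s -> dval s < 10 ^ size s.
Proof.
elim/last_ind: s => [//|s x IH].
rewrite /digits all_rcons dval_rcons size_rcons expnS => /andP[x10 /IH]; lia.
Qed.

Lemma dval_ge d s : 0 < d -> 10 ^ size s <= dval (d :: s).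
Proof. by move=> d0; rewrite dval_cons; nia. Qed.

Lemma size_le d s T : 0 < d -> dval (d :: s) < 10 ^ T.+1 -> size s <= T.
Proof.
by move=> d0 lt; have := leq_ltn_trans (dval_ge s d0) lt; rewrite ltn_exp2l.
Qed.

Lemma dval_nines n : (dval (nseq n 9)).+1 = 10 ^ n.
Proof. elim: n => [//|n IH]; rewrite /= dval_cons size_nseq expnS; lia. Qed.

Lemma dval_mod9 s : dval s = sumn s %[mod 9].
Proof.
elim/last_ind: s => [//|s x IH].
by rewrite dval_rcons sumn_rcons -modnDml -modnMmr IH modnMmr; lia.
Qed.

Lemma digit_expansion a : 0 < a ->
  exists d s, [/\ 0 < d, digits (d :: s) & a = dval (d :: s)].
Proof.
elim/ltn_ind: a => a IH a0; case: (ltnP a 10) => [a10|a10].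
  by exists a, [::]; rewrite /digits /= a10.
have [||d [s [d0 ds e]]] := IH (a %/ 10); try lia.
exists d, (rcons s (a %% 10)); split=> //.
  move: ds; rewrite /digits /= all_rcons; lia.
by rewrite -rcons_cons dval_rcons -e; lia.
Qed.

Lemma digit_dval s i : digits s -> digit (dval s) i = nth 0 (rev s) i.
Proof.
elim/last_ind: s i => [|s x IH] i; first by rewrite /digit div0n nth_nil.
rewrite /digits all_rcons dval_rcons rev_rcons => /andP[x10 ds].
case: i => [|i] /=; first by rewrite /digit expn0 divn1; lia.
rewrite -IH // /digit expnS divnMA; congr (_ %/ _ %% _); lia.
Qed.

Lemma digit_tail d s j : digits (d :: s) -> j < size s ->
  digit (dval (d :: s)) j = nth 0 s (size s - j.+1).
Proof.
move=> ds lt; rewrite digit_dval // nth_rev /=; last by lia.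
by have -> : (size s).+1 - j.+1 = (size s - j.+1).+1 by lia.
Qed.

Lemma top_dval d s : 0 < d -> digits (d :: s) -> top (dval (d :: s)) = size s.
Proof.
by move=> d0 ds; apply: trunc_log_eq => //; rewrite dval_ge //= dval_lt.
Qed.

Lemma E2_dval d s :
  0 < d -> digits (d :: s) -> E2 (dval (d :: s)) = d * (d * d + sumsq s).
Proof.
move=> d0 ds; rewrite /E2 top_dval // digit_dval // nth_rev //= subnn /=.
congr (_ * _); transitivity (\sum_(x <- rev (d :: s)) x ^ 2).
  rewrite (big_nth 0) size_rev big_mkord.
  by apply: eq_bigr => i _; rewrite digit_dval.
rewrite (perm_big _ (permEl (perm_rev (d :: s)))) /= big_cons; congr (_ + _).
by rewrite /sumsq sumnE big_map; apply: eq_bigr => x _.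
Qed.

(** This is why deficits control the size: for a prescribed sum of squares, one
    digit fewer costs 81 units of deficit. *)
Lemma sumsqD s : digits s -> sumsq s + deficit s = 81 * size s.
Proof. by rewrite /sumsq /deficit; elim: s => //= x s IH /andP[x10 /IH]; nia. Qed.

Lemma deficit_cat s t : deficit (s ++ t) = deficit s + deficit t.
Proof. by rewrite /deficit map_cat sumn_cat. Qed.

Lemma deficit_split u t v :
  deficit (u ++ t ++ v) = deficit u + deficit v + deficit t.
Proof. by rewrite !deficit_cat; lia. Qed.

Lemma sumsq_cat s t : sumsq (s ++ t) = sumsq s + sumsq t.
Proof. by rewrite /sumsq map_cat sumn_cat. Qed.

Lemma sumsq_nines n : sumsq (nseq n 9) = 81 * n.
Proof. by rewrite /sumsq map_nseq sumn_nseq. Qed.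

Lemma digits_cat s t : digits (s ++ t) = digits s && digits t.
Proof. exact: all_cat. Qed.

Lemma digits_nines n : digits (nseq n 9).
Proof. by rewrite /digits all_nseq orbT. Qed.

Lemma deficit0 s : digits s -> deficit s = 0 -> s = nseq (size s) 9.
Proof.
rewrite /deficit; elim: s => //= x s IH /andP[x10 ds] e.
by rewrite -IH //; [congr (_ :: _); nia | lia].
Qed.

Lemma digits_ge lo s : digits s -> all (leq lo) s -> all (fun x => lo <= x < 10) s.
Proof. by move=> ds ge; rewrite all_predI; apply/andP. Qed.

Lemma split3 (s : seq nat) p m q : size s = p + (m + q) ->
  exists u t v, [/\ s = u ++ t ++ v, size u = p, size t = m & size v = q].
Proof.
move=> sz; exists (take p s), (take m (drop p s)), (drop m (drop p s)).
by rewrite !cat_take_drop !size_take_min !size_drop sz; split=> //; lia.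
Qed.

Lemma dval_block9 u m : dval (u ++ nseq m 9) + 1 = (dval u).+1 * 10 ^ m.
Proof. by have := dval_nines m; rewrite dval_cat size_nseq; nia. Qed.

Lemma dval_block888 u m :
  dval (u ++ nseq m 9 ++ [:: 8; 8; 8]) + 112 = (dval u).+1 * 10 ^ (m + 3).
Proof.
rewrite catA dval_cat expnD (_ : dval [:: 8; 8; 8] = 888) // [size _]/=.
by have := dval_block9 u m; nia.
Qed.

Lemma dvd8_suffix s v : size v = 3 -> (8 %| dval (s ++ v)) = (8 %| dval v).
Proof.
by move=> sz; rewrite dval_cat sz (_ : 10 ^ 3 = 125 * 8) // mulnA dvdn_addr ?dvdn_mull.
Qed.

Lemma prefix_le u t b : dval (8 :: u ++ t) < (8 * 10 ^ size u + b.+1) * 10 ^ size t ->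
  dval u <= b.
Proof. by rewrite -cat_cons dval_cat dval_cons; nia. Qed.

Lemma basic_dval d s : 0 < d -> digits (d :: s) ->
  basic (dval (d :: s)) <->
  [/\ 10 < dval (d :: s), all (leq 1) s & sorted leq s].
Proof.
move=> d0 ds; rewrite /basic top_dval //; split=> -[a10 s1 s2]; split=> //.
- apply/(all_nthP 0) => i lt; have := s1 (size s - i.+1) ltac:(lia).
  rewrite digit_tail //; last by lia.
  have -> : size s - (size s - i.+1).+1 = i by lia.
  by rewrite lt0n => /eqP.
- apply/(sortedP 0) => i lt.
  have := s2 (size s - i.+2) (size s - i.+1) ltac:(lia) ltac:(lia).
  rewrite !digit_tail //; try lia.
  have -> : size s - (size s - i.+1).+1 = i by lia.
  by have -> : size s - (size s - i.+2).+1 = i.+1 by lia.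
- move=> i lt; rewrite digit_tail //; apply/eqP; rewrite -lt0n.
  by apply: (all_nthP 0 s1); lia.
- move=> i j le lt; rewrite !digit_tail //; last by lia.
  by apply: (sorted_leq_nth leq_trans leqnn 0 s2); rewrite ?inE; lia.
Qed.

(** * Recursion for the height *)

Lemma E2_gt0 a : 0 < a -> 0 < E2 a.
Proof. by case/digit_expansion => d [s [d0 ds ->]]; rewrite E2_dval //; nia. Qed.

Lemma heightS k a : 0 < a ->
  elated_of_height k.+1 a = (a != 1) && elated_of_height k (E2 a).
Proof.
move=> a0; rewrite /elated_of_height a0 E2_gt0 //= -iterSr.
apply/andP/andP => [[e /forallP n1] | [n1 /andP[e /forallP n1']]].
  split; first exact: (n1 ord0).
  rewrite e; apply/forallP=> m.
  by have := n1 (lift ord0 m); rewrite lift0 iterSr.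
split=> //; apply/forallP=> -[[|m] lt_m] //=.
by rewrite -iterS iterSr (n1' (Ordinal (lt_m : m < k))).
Qed.

Lemma heightS_dval k a : elated_of_height k.+1 a ->
  exists d s, [/\ 0 < d < 10, digits s, a = dval (d :: s)
                & elated_of_height k (d * (d * d + sumsq s))].
Proof.
move=> h; have a0 : 0 < a by case/and3P: h.
move: h; rewrite heightS // => /andP[_].
have [d [s [d0 ds ->]]] := digit_expansion a0; rewrite E2_dval // => h.
by exists d, s; case/andP: ds => d10 ds; rewrite d0.
Qed.

Lemma heightS_cons k d s : 0 < d -> digits (d :: s) -> s != [::] ->
  elated_of_height k.+1 (dval (d :: s)) = elated_of_height k (d * (d * d + sumsq s)).
Proof.
move=> d0 ds s0; have ge := dval_ge s d0.
have : 10 ^ 1 <= 10 ^ size s by rewrite leq_exp2l; case: s s0 {ds ge}.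
by move=> ge10; rewrite heightS ?E2_dval //; [case: eqP => //; lia | lia].
Qed.

(** * Deficits and digit sums modulo 9 *)

(** The row for the deficit [r.+1], given the list [t] of the rows for [r], [r -
    1], ..., 0: a residue is possible if removing one digit [x < 9] of the word
    leads to a possible residue of the row [80 - x * x] places down the list.
    Only digits [x >= lo] may occur, and nines are left out because they change
    neither the deficit nor the digit sum modulo 9. *)
Definition next_row (lo : nat) (t : seq (seq nat)) : seq nat :=
  [seq s <- iota 0 9 |
    has (fun x => (s + 9 - x) %% 9 \in nth [::] t (80 - x * x)) (iota lo (9 - lo))].

Fixpoint rows (lo n : nat) : seq (seq nat) :=
  if n is m.+1 then let t := rows lo m in next_row lo t :: t else [:: [:: 0]].

(** The residues modulo 9 of the digit sums of all words with deficit [r] and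
    digits at least [lo]; it is empty exactly when no such word exists. *)
Definition residues lo r := head [::] (rows lo r).

Lemma nth_rows lo n i : i <= n -> nth [::] (rows lo n) i = residues lo (n - i).
Proof.
elim: n i => [|n IH] [|i] // le_in.
by rewrite [LHS]/= IH.
Qed.

Lemma residuesS lo r s x : lo <= x < 9 -> s \in residues lo r -> s < 9 ->
  (s + x) %% 9 \in residues lo (r + (81 - x * x)).
Proof.
move=> /andP[lox x9] sr s9.
have -> : r + (81 - x * x) = (r + (80 - x * x)).+1 by nia.
rewrite /residues /= mem_filter mem_iota /= ltn_mod !andbT; apply/hasP; exists x.
  by rewrite mem_iota; lia.
rewrite nth_rows ?leq_addl // addnK.
by have -> : ((s + x) %% 9 + 9 - x) %% 9 = s by lia.
Qed.

(** Induction on the word: adding a digit [x < 9] moves [81 - x * x] rows up and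
    shifts the residue by [x]; adding a nine does nothing. *)
Lemma residuesP lo s : all (fun x => lo <= x < 10) s ->
  sumn s %% 9 \in residues lo (deficit s).
Proof.
elim: s => [|x s IH] //= /andP[/andP[lox x10] /IH]; rewrite /deficit /= => sr.
have [->|x9] : x = 9 \/ x < 9 by lia.
  by have -> : (9 + sumn s) %% 9 = sumn s %% 9 by lia.
have -> : (x + sumn s) %% 9 = (sumn s %% 9 + x) %% 9 by lia.
by rewrite (addnC (81 - x * x)) residuesS ?ltn_mod ?lox.
Qed.

Lemma unreachable_ge lo s r : residues lo r = [::] -> digits s -> all (leq lo) s ->
  deficit s <> r.
Proof.
move=> e ds ge rs; have := residuesP (digits_ge ds ge).
by rewrite rs e.
Qed.

Lemma unreachable s r : residues 0 r = [::] -> digits s -> deficit s <> r.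
Proof. by move=> e ds; apply: (unreachable_ge e ds); apply/allP. Qed.

(** Here [t] stands for [rows 0 168], passed as an argument so that a search
    over many words computes this table once.  168 is the largest deficit that
    occurs. *)
Definition reach (t : seq (seq nat)) (r : nat) : bool := nth [::] t (168 - r) != [::].

Lemma digits_reach s : digits s -> deficit s <= 168 -> reach (rows 0 168) (deficit s).
Proof.
move=> ds le; rewrite /reach nth_rows ?leq_subr // subKn //.
by have := @residuesP 0 s ds; case: (residues _ _).
Qed.

(** A necessary condition for [w] to be part of a word of deficit [r]: the rest
    of the word must have a deficit that some word has. *)
Definition admissible (t : seq (seq nat)) (r : nat) (w : seq nat) : bool :=
  (deficit w <= r) && reach t (r - deficit w).

Lemma admissibleP r w t : r <= 168 -> digits t -> deficit w + deficit t = r ->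
  admissible (rows 0 168) r w.
Proof.
move=> r168 dt e; by rewrite /admissible -e leq_addr addKn digits_reach //; lia.
Qed.

(** * Digits forced by the deficit *)

Definition words (n : nat) : seq (seq nat) :=
  iter n (fun ws => [seq x :: w | x <- iota 0 10, w <- ws]) [:: [::]].

Lemma mem_words s : digits s -> s \in words (size s).
Proof.
elim: s => // x s IH /andP[x10 ds]; rewrite /words [size _]/= iterS.
by apply: allpairs_f; [rewrite mem_iota | apply: IH].
Qed.

Lemma mem_words_size n s : digits s -> size s = n -> s \in words n.
Proof. by move=> ds <-; apply: mem_words. Qed.

(** A finite search for what the deficit [r] imposes on a prefix or suffix.  The
    conditional keeps the costlier tests from being evaluated on inadmissible
    words. *)
Definition forces (t : seq (seq nat)) (r : nat) (ws : seq (seq nat))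
    (p q : pred (seq nat)) : bool :=
  all (fun w => if admissible t r w then p w ==> q w else true) ws.

Lemma forcesP r ws p q w t : forces (rows 0 168) r ws p q -> r <= 168 -> w \in ws ->
  digits t -> deficit w + deficit t = r -> p w -> q w.
Proof.
move=> /allP/(_ w) f r168 /f{}f dt e; move: f.
by rewrite (admissibleP r168 dt e) => /implyP.
Qed.

(** A word of deficit [r] whose first [n] digits are at most [b] has the prefix
    [u], which uses up the whole deficit, so nines follow. *)
Lemma prefix_forced n b d T r u s :
    forces (rows 0 168) r (words n) (fun w => dval w <= b) (pred1 u) ->
    r <= 168 -> deficit u = r -> n <= T ->
    digits s -> size s = T -> deficit s = r ->
  dval (d :: s) < (d * 10 ^ n + b.+1) * 10 ^ (T - n) ->
  s = u ++ nseq (T - n) 9.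
Proof.
move=> f r168 du nT ds sz rs lt.
have [|w [t [v [sE szw szt szv]]]] := @split3 s n (T - n) 0; first by lia.
case: v szv sE => // _; rewrite cats0 => sE.
move: ds rs lt; rewrite sE digits_cat deficit_cat => /andP[dw dt] rs lt.
have le : dval w <= b.
  by move: lt; rewrite -cat_cons dval_cat dval_cons szt szw; nia.
have /eqP wE : w == u by apply: (forcesP f r168 _ dt rs le); apply: mem_words_size.
by rewrite wE in rs *; rewrite (@deficit0 t) ?szt //; lia.
Qed.

Lemma suffix_51 : forces (rows 0 168) 51 (words 3) (fun w => 8 %| dval w)
  (pred1 [:: 8; 8; 8]).
Proof. by vm_compute. Qed.

(** The prefixes up to 37 and, below, the three-digit suffixes divisible by 8
    that the deficit 168 allows; only one pair of them fits together. *)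
Definition prefixes_168 := [:: [:: 1; 5]; [:: 1; 7]; [:: 1; 9]; [:: 3; 6]; [:: 3; 7]].

Definition suffixes_168 :=
  [:: [:: 3; 6; 8]; [:: 6; 8; 8]; [:: 8; 8; 8]; [:: 8; 9; 6]; [:: 9; 3; 6]; [:: 9; 6; 8]].

Lemma prefix_168 : forces (rows 0 168) 168 (words 2) (fun w => dval w <= 37)
  (mem prefixes_168).
Proof. by vm_compute. Qed.

Lemma suffix_168 : forces (rows 0 168) 168 (words 3) (fun w => 8 %| dval w)
  (mem suffixes_168).
Proof. by vm_compute. Qed.

Lemma prefix_suffix_168 : forces (rows 0 168) 168
  [seq x ++ y | x <- prefixes_168, y <- suffixes_168] xpredT
  (pred1 [:: 3; 6; 8; 8; 8]).
Proof. by vm_compute. Qed.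

Lemma suffix_105 : forces (rows 0 168) 105 (words 3) xpredT
  (fun w => ~~ (8 %| dval w)).
Proof. by vm_compute. Qed.

(** The bound is 5790 rather than 5789 because the comparison with [8578]
    followed by nines allows a slight excess; a digit 0 in fourth place would
    cost a deficit of 81. *)
Lemma prefix_105 : forces (rows 0 168) 105 (words 4)
  (fun w => dval w <= 579 * 10) (pred1 [:: 5; 7; 8; 9]).
Proof. by vm_compute. Qed.

Lemma prefix_99 : forces (rows 0 168) 99 (words 3)
  (fun w => dval w <= 488) (pred1 [:: 4; 8; 8]).
Proof. by vm_compute. Qed.

(** * Numbers with leading digit 8 and given deficit *)

Definition in_class (T r c : nat) : Prop :=
  exists s, [/\ size s = T, digits s, deficit s = r & c = dval (8 :: s)].

Definition classified (k T r : nat) : Prop :=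
  forall c, elated_of_height k c -> c < 10 ^ T.+1 -> in_class T r c.

Lemma class_ge T r c : in_class T r c -> 8 * 10 ^ T <= c.
Proof. by case=> s [<- _ _ ->]; rewrite dval_cons leq_addr. Qed.

Lemma classified_ge k T r c :
  classified k T r -> elated_of_height k c -> 8 * 10 ^ T <= c.
Proof.
move=> cl h; case: (ltnP c (10 ^ T.+1)) => [lt|]; first exact: class_ge (cl c h lt).
by rewrite expnS; lia.
Qed.

(** If 9 divides [c], the digits after the leading 8 sum to 1 modulo 9. *)
Lemma class_mod9 T r c : in_class T r c -> 9 %| c -> 1 \in residues 0 r.
Proof.
case=> s [_ ds <- ->]; rewrite /dvdn dval_mod9 /= => e.
by have := @residuesP 0 s ds; have -> : sumn s %% 9 = 1 by lia.
Qed.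

(** The deficit 51 is [3 * 17] and in no other way a sum of digit deficits, so
    the nine digits are six nines and three eights; for 8 to divide an even
    number of this kind, the eights must come last. *)
Lemma class_9_51_dvd8 c : in_class 9 51 c -> 8 %| c ->
  c = dval (8 :: nseq 6 9 ++ [:: 8; 8; 8]).
Proof.
case=> s [sz ds rs ->]; have [u [t [v [sE szu szt szv]]]] := @split3 s 0 6 3 sz.
case: u szu sE => // _; rewrite cat0s => sE.
move: ds rs; rewrite sE -cat_cons dvd8_suffix // digits_cat deficit_cat.
move=> /andP[dt dv] rs dvd.
have /eqP vE : v == [:: 8; 8; 8].
  apply: (@forcesP _ _ _ _ v t suffix_51) => //.
  - exact: mem_words_size.
  - by rewrite addnC.
rewrite vE (@deficit0 t) ?szt //; last by rewrite vE /deficit /= -/(deficit t) in rs; lia.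
Qed.

(** Many arrangements of deficit 168 are divisible by 8, but the least of them,
    [836] followed by nines and [888], is the only one below [838 * 10 ^ (T -
    2)]. *)
Lemma class_168_dvd8 T c : 5 <= T -> in_class T 168 c -> 8 %| c ->
  c < 838 * 10 ^ (T - 2) -> c = dval (8 :: [:: 3; 6] ++ nseq (T - 5) 9 ++ [:: 8; 8; 8]).
Proof.
move=> T5 [s [sz ds rs ->]].
have [|u [t [v [sE szu szt szv]]]] := @split3 s 2 (T - 5) 3; first by lia.
move: ds rs; rewrite sE !digits_cat deficit_split => /and3P[du dt dv] rs.
rewrite {1}catA -cat_cons dvd8_suffix // => dvd lt.
have le37 : dval u <= 37.
  apply: (@prefix_le u (t ++ v)); rewrite size_cat szu szt szv.
  by have -> : T - 5 + 3 = T - 2 by lia.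
have uL : u \in prefixes_168.
  apply: (@forcesP _ _ _ _ u (v ++ t) prefix_168) => //.
  - exact: mem_words_size.
  - by rewrite digits_cat dv.
  - by rewrite deficit_cat; lia.
have vM : v \in suffixes_168.
  apply: (@forcesP _ _ _ _ v (u ++ t) suffix_168) => //.
  - exact: mem_words_size.
  - by rewrite digits_cat du.
  - by rewrite deficit_cat; lia.
have /eqP uvE : u ++ v == [:: 3; 6; 8; 8; 8].
  apply: (@forcesP _ _ _ _ (u ++ v) t prefix_suffix_168) => //.
  - exact: allpairs_f.
  - by rewrite deficit_cat.
have [uE vE] : u = [:: 3; 6] /\ v = [:: 8; 8; 8].
  by case: u szu {du rs le37 uL sE lt} uvE => [|a [|b []]] //= _ [-> -> ->].
rewrite uE vE in rs *; rewrite (@deficit0 t) ?szt //.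
by move: rs; rewrite /deficit /= -/(deficit t); lia.
Qed.

(** After the leading 8 the only digits other than 9 are 5, 7 and 8; an even
    number of this kind ends in 8 preceded by an odd digit, so that not even 4
    divides it. *)
Lemma class_105_ndvd8 T c : 3 <= T -> in_class T 105 c -> ~~ (8 %| c).
Proof.
move=> T3 [s [sz ds rs ->]].
have [|u [t [v [sE szu szt szv]]]] := @split3 s 0 (T - 3) 3; first by lia.
case: u szu sE => // _; rewrite cat0s => sE.
move: ds rs; rewrite sE -cat_cons dvd8_suffix // digits_cat deficit_cat.
move=> /andP[dt dv] rs.
apply: (@forcesP _ _ _ _ v t suffix_105) => //.
- exact: mem_words_size.
- by rewrite addnC.
Qed.

(** A number in the excluded range has leading digit 1 and [T.+2] digits, so its
    image is at most [1 + 81 * T.+1], too small to have height [k]. *)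
Lemma no_leading_one k T B c : (forall v, elated_of_height k v -> B <= v) ->
  81 * T.+1 + 1 < B -> elated_of_height k.+1 c -> c < 2 * 10 ^ T.+1 ->
  c < 10 ^ T.+1.
Proof.
move=> ge_B T_B /heightS_dval[d [s [d10 ds -> /ge_B]]] lt2 lt.
rewrite ltnNge; apply/negP => ge.
have szl : T < size s.
  have := leq_ltn_trans ge (@dval_lt (d :: s) _).
  by rewrite ltn_exp2l // ltnS; apply; case/andP: d10 => _ d10; apply/andP.
have szr : size s <= T.+1.
  rewrite leqNgt; apply/negP => gt.
  have := dval_ge s (proj1 (andP d10)).
  have : 10 ^ T.+2 <= 10 ^ size s by rewrite leq_exp2l.
  by rewrite expnS; lia.
have sz : size s = T.+1 by lia.
have d1 : d = 1 by move: lt; rewrite dval_cons sz; nia.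
have := sumsqD ds; rewrite d1 in lt2 *; lia.
Qed.

Lemma image_in_class k T r B c d S : classified k.+1 T r -> 1 \notin residues 0 r ->
  (forall v, elated_of_height k v -> B <= v) -> 81 * T.+1 + 1 < B ->
  elated_of_height k.+1 c -> c = d * S -> c < 2 * 10 ^ T.+1 ->
  in_class T r c /\ d <> 9.
Proof.
move=> cl n1 ge_B T_B h cE lt.
have inC : in_class T r c by apply: cl (no_leading_one ge_B T_B h lt).
split=> // d9; move/negP: n1; apply; apply: class_mod9 inC _.
by rewrite cE d9 dvdn_mulr.
Qed.

(** * Heights 11 and 12 *)

(** The leading digit and the sum of the squared digits, in binary arithmetic to
    make the search at height 11 fast.  [fuel] bounds the number of digits. *)
Fixpoint lead_sumsq (fuel : nat) (n : N) : N * N :=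
  if fuel is f.+1 then
    if N.ltb n 10 then (n, N.mul n n) else
    let (q, r) := N.div_eucl n 10 in
    let (l, t) := lead_sumsq f q in (l, N.add t (N.mul r r))
  else (0%num, 0%num).

(** Four digits suffice: [E2] maps the numbers below [10 ^ 4] into the same
    range. *)
Definition E2N (n : N) : N := let (l, t) := lead_sumsq 4 n in N.mul l t.

Fixpoint heightN (k : nat) (n : N) : bool :=
  if k is k'.+1 then ~~ N.eqb n 1 && heightN k' (E2N n) else N.eqb n 1.

Lemma lead_sumsqP f n : (0 < N.to_nat n < 10 ^ f)%N ->
  exists d s, [/\ 0 < d, digits (d :: s), N.to_nat n = dval (d :: s),
    d = N.to_nat (lead_sumsq f n).1 & d * d + sumsq s = N.to_nat (lead_sumsq f n).2].
Proof.
elim: f n => [|f IH] n /andP[n0 nf]; first by lia.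
rewrite [lead_sumsq _ _]/=; case: N.ltb_spec => [n10|n10].
  exists (N.to_nat n), [::]; rewrite /digits /sumsq /=; split=> //; lia.
have := N.div_eucl_spec n 10; have := N.mod_lt n 10 ltac:(by []).
rewrite /N.modulo; case: N.div_eucl => q r; rewrite [(_, _).2]/= => r10 nE.
have [|d [s [d0 ds qE dE tE]]] := IH q; first by move: nf; rewrite expnS; lia.
case: (lead_sumsq f q) dE tE => l t /= dE tE.
exists d, (rcons s (N.to_nat r)); split=> //.
- by move: ds; rewrite /digits /= all_rcons; lia.
- by rewrite -rcons_cons dval_rcons -qE; lia.
- by rewrite -cats1 sumsq_cat /sumsq /= -/(sumsq s); lia.
Qed.

Lemma E2N_E2 n : (0 < N.to_nat n < 10 ^ 4)%N ->
  E2 (N.to_nat n) = N.to_nat (E2N n) /\ (0 < N.to_nat (E2N n) < 10 ^ 4)%N.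
Proof.
move=> nb; have [d [s [d0 ds nE dE tE]]] := lead_sumsqP nb.
have e : E2 (N.to_nat n) = N.to_nat (E2N n).
  by rewrite nE E2_dval // tE dE /E2N; case: lead_sumsq => l t /=; lia.
split=> //; rewrite -e E2_gt0 /=; last by case/andP: nb.
have sz : size s <= 3.
  have : 10 ^ size s < 10 ^ 4 by apply: leq_ltn_trans (dval_ge s d0) _; lia.
  by rewrite ltn_exp2l.
case/andP: (ds) => d10 ds'; have := sumsqD ds'.
rewrite nE E2_dval //; nia.
Qed.

Lemma heightNP k n : (0 < N.to_nat n < 10 ^ 4)%N ->
  elated_of_height k (N.to_nat n) = heightN k n.
Proof.
elim: k n => [|k IH] n nb.
  rewrite /elated_of_height /=; case/andP: nb => -> _ /=.
  have -> : [forall m : 'I_0, iter m E2 (N.to_nat n) != 1] by apply/forallP=> -[].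
  by rewrite andbT; case: N.eqb_spec; lia.
have [n0 _] := andP nb; have [e eb] := E2N_E2 nb.
rewrite heightS // e IH //=; congr (~~ _ && _).
by case: N.eqb_spec; lia.
Qed.

Fixpoint allN (len : nat) (n : N) (p : pred N) : bool :=
  if len is l.+1 then p n && allN l (N.succ n) p else true.

Lemma allNP len n p : allN len n p ->
  forall m, (N.to_nat n <= m < N.to_nat n + len)%N -> p (N.of_nat m).
Proof.
elim: len n => [|l IH] n /=; first by lia.
case/andP=> pn /IH h m hm; have [->|ne] := eqVneq m (N.to_nat n).
  by rewrite Nnat.N2Nat.id.
by apply: h; lia.
Qed.

(** The bound [7290 = 9 * (81 * 10)] is the largest value of [E2] on ten-digit
    numbers. *)
Lemma elated11_small c : c <= 729 * 10 -> elated_of_height 11 c ->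
  c \in [seq N.to_nat n | n <- [:: 5369; 5396; 5639; 5693; 5936; 5963]%num].
Proof.
move=> le h; have c0 : 0 < c by case/and3P: h.
set L := [:: _; _; _; _; _; _].
have : allN (729 * 10) 1 (fun n => if heightN 11 n then has (N.eqb n) L else true).
  by vm_compute.
move/allNP/(_ c); rewrite -heightNP Nnat.Nat2N.id ?h; last by lia.
move=> /(_ ltac:(lia))/hasP[n nL /N.eqb_spec e].
by apply/mapP; exists n => //; rewrite -e Nnat.Nat2N.id.
Qed.

Lemma elated11_5936 : elated_of_height 11 (N.to_nat 5936).
Proof. by rewrite heightNP; [vm_compute | lia]. Qed.

Lemma elated11_gt c : elated_of_height 11 c -> 811 < c.
Proof.
move=> h; rewrite ltnNge; apply/negP => le.
by have /elated11_small := h; rewrite !inE; lia.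
Qed.

(** Among the six candidates for [E2 a], only [5936 = 8 * (64 + 678)] and [5369
    = 7 * (49 + 718)] have the form [d * (d ^ 2 + sumsq s)] with at most nine
    digits in [s] and [d >= 7], and the latter would need the deficit 11. *)
Lemma elated12_class : classified 12 9 51.
Proof.
move=> a /heightS_dval[d [s [/andP[d0 d10] ds -> h]]] lt.
have sz := size_le d0 lt; have sq := sumsqD ds.
have dS : d * (d * d + sumsq s) <= d * (d * d + 81 * 9) by rewrite leq_pmul2l //; lia.
(* With [d <= 6] the image is below 5369. *)
have [|d7] := leqP d 6.
  move=> d6; have : d * (d * d + 81 * 9) <= 6 * (6 * 6 + 81 * 9) by nia.
  move=> le; have /elated11_small := h; rewrite !inE; lia.
have /elated11_small := h; rewrite !inE => /(_ ltac:(nia)) hc.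
have e11 : deficit s <> 11 by apply: unreachable.
have [dE | [dE | dE]] : d = 7 \/ d = 8 \/ d = 9 by lia.
- by rewrite dE in hc; lia.
- by rewrite dE in hc *; exists s; split=> //; lia.
- by rewrite dE in hc; lia.
Qed.

(** * The lengths of the numbers of heights 13, 14 and 15 *)

(** The number of non-leading digits at height 13: the image is [9 * 10 ^ 9 -
    112], which is [8 * (64 + 81 * T - 168)].  Only this equation is used. *)
Lemma top13_ex : {T | 9 * T = 125 * 10 ^ 6 + 10}.
Proof. by exists ((125 * 10 ^ 6 + 10) %/ 9); lia. Qed.

Definition top13 : nat := sval top13_ex.

Lemma top13E : 9 * top13 = 125 * 10 ^ 6 + 10.
Proof. exact: svalP top13_ex. Qed.

(** [567 = 7 * 81] is the modulus that decides whether the numbers at heights 14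
    and 15 are integers; 18 is a period of the powers of 10 modulo both factors.
    *)
Lemma expn10_18 q : exists z, 10 ^ (18 * q) = 567 * z + 1.
Proof.
have [r e] : exists r, 10 ^ 18 = r * 567 + 1 by exists (10 ^ 18 %/ 567); lia.
rewrite expnM; move: (10 ^ 18) e => _ ->.
by have := modnMDXl r 1 q 567; rewrite exp1n; exists ((r * 567 + 1) ^ q %/ 567); lia.
Qed.

(** The number of non-leading digits at height 14: the image is [837 * 10 ^
    (top13 - 2) - 112], which is [8 * (64 + 81 * T - 105)].  Its residue modulo
    18 is what makes the next division exact. *)
Lemma top14_ex : {T | 3 * T = 3875 * 10 ^ (top13 - 5) + 1 /\ T %% 18 = 11}.
Proof.
exists ((3875 * 10 ^ (top13 - 5) + 1) %/ 3).
have e := top13E; pose q := (top13 - 18) %/ 18.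
have -> : top13 - 5 = 13 + 18 * q by rewrite /q; lia.
have [z] := expn10_18 q; rewrite expnD; move: (10 ^ (18 * q)) => Y ->; lia.
Qed.

Definition top14 : nat := sval top14_ex.

Lemma top14E : 3 * top14 = 3875 * 10 ^ (top13 - 5) + 1.
Proof. by case: (svalP top14_ex). Qed.

Lemma top14_mod : top14 %% 18 = 11.
Proof. by case: (svalP top14_ex). Qed.

(** [E2] of [7488] followed by [n] nines is [7 * (193 + 81 * n)], and this must
    be [8578] followed by nines. *)
Lemma nines15_ex : {n | 7 * (193 + 81 * n) + 1 = (8 * 10 ^ 3 + 579) * 10 ^ (top14 - 3)}.
Proof.
exists (((8 * 10 ^ 3 + 579) * 10 ^ (top14 - 3) - 1 - 1351) %/ 567).
have e := top14_mod; pose q := top14 %/ 18.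
have -> : top14 - 3 = 8 + 18 * q by rewrite /q; lia.
have [z] := expn10_18 q; rewrite expnD; move: (10 ^ (18 * q)) => Y ->; lia.
Qed.

Definition nines15 : nat := sval nines15_ex.

Lemma nines15E : 7 * (193 + 81 * nines15) + 1 = (8 * 10 ^ 3 + 579) * 10 ^ (top14 - 3).
Proof. exact: svalP nines15_ex. Qed.

(** * Heights 13 and 14 *)

(** The image is [9 * 10 ^ 9 - 112], which leaves the deficit 168, or 87 or 6
    with one or two digits fewer; neither 87 nor 6 is a sum of digit deficits.
    *)
Lemma elated13_class : classified 13 top13 168.
Proof.
move=> a /heightS_dval[d [s [/andP[d0 d10] ds -> h]]] lt.
have tE := top13E; have sz := size_le d0 lt; have sq := sumsqD ds.
have sqT : d * d + sumsq s <= 81 * top13.+1 by nia.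
have le : d * (d * d + sumsq s) <= d * (81 * top13.+1) by rewrite leq_pmul2l.
have [|||inC d9] := image_in_class (S := d * d + sumsq s) (d := d) elated12_class _ elated11_gt _ h erefl.
- by vm_compute.
- by vm_compute.
- by have : d * (81 * top13.+1) <= 9 * (81 * top13.+1) by [rewrite leq_mul2r; lia]; lia.
(* The image is at least [8 * 10 ^ 9], too large for [d <= 7]. *)
have d8 : d = 8.
  have := class_ge inC; case: (leqP d 7) => d7; last by lia.
  by have : d * (81 * top13.+1) <= 7 * (81 * top13.+1) by [rewrite leq_mul2r; lia]; lia.
rewrite d8 in inC lt *.
have cE := class_9_51_dvd8 inC (dvdn_mulr _ (dvdnn 8)).
have := dval_block888 [:: 8] 6; rewrite cat_cons cat0s -cE (_ : dval [:: 8] = 8) //.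
move=> {cE}cE; exists s.
have e6 := @unreachable s 6 erefl ds; have e87 := @unreachable s 87 erefl ds.
by split=> //; lia.
Qed.

(** The image is [836] followed by nines and [888], which leaves the deficit
    105, or 24 with one digit fewer, and 24 is not a sum of digit deficits. *)
Lemma elated14_class : classified 14 top14 105.
Proof.
move=> a /heightS_dval[d [s [/andP[d0 d10] ds -> h]]] lt.
have tE := top13E; have tE' := top14E; have sz := size_le d0 lt; have sq := sumsqD ds.
have Xgt : 0 < 10 ^ (top13 - 5) by rewrite expn_gt0.
have XE : 10 ^ top13 = 10 ^ 5 * 10 ^ (top13 - 5) by rewrite -expnD; congr (_ ^ _); lia.
have YE : 10 ^ (top13 - 2) = 10 ^ 3 * 10 ^ (top13 - 5).
  by rewrite -expnD; congr (_ ^ _); lia.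
have sqT : d * d + sumsq s <= 81 * top14.+1 by nia.
have le : d * (d * d + sumsq s) <= d * (81 * top14.+1) by rewrite leq_pmul2l.
have ge12 := @classified_ge _ _ _ _ elated12_class.
have [|||inC d9] := image_in_class (S := d * d + sumsq s) (d := d) elated13_class _ ge12 _ h erefl.
- by vm_compute.
- by lia.
- have : d * (81 * top14.+1) <= 9 * (81 * top14.+1) by [rewrite leq_mul2r; lia].
  by rewrite expnS XE; lia.
have d8 : d = 8.
  have := class_ge inC; case: (leqP d 7) => d7; last by lia.
  have : d * (81 * top14.+1) <= 7 * (81 * top14.+1) by [rewrite leq_mul2r; lia].
  by rewrite XE; lia.
rewrite d8 in inC lt *.
have cE : 8 * (8 * 8 + sumsq s) + 112 = 837 * 10 ^ (top13 - 2).
  have -> : top13 - 2 = top13 - 5 + 3 by lia.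
  rewrite -(dval_block888 [:: 8; 3; 6]); congr (_ + _).
  by apply: class_168_dvd8 inC (dvdn_mulr _ (dvdnn 8)) _; [lia | rewrite YE; lia].
rewrite YE in cE; exists s.
have e24 := @unreachable s 24 erefl ds.
by split=> //; lia.
Qed.

Definition least14 : nat := dval (8 :: [:: 5; 7; 8] ++ nseq (top14 - 3) 9).

Lemma least14E : least14 = 7 * (193 + 81 * nines15).
Proof.
have := dval_block9 [:: 8; 5; 7; 8] (top14 - 3); have := nines15E.
have -> : (dval [:: 8; 5; 7; 8]).+1 = 8 * 10 ^ 3 + 579 by [].
rewrite !cat_cons !cat0s -/least14; lia.
Qed.

Lemma elated14_least14 : elated_of_height 14 least14.
Proof.
have e13 := top13E; have e14 := top14E; have m14 := top14_mod.
have s888 : sumsq [:: 8; 8; 8] = 192 by [].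
have s36 : sumsq [:: 3; 6] = 45 by [].
have XE : 10 ^ (top13 - 5 + 3) = 10 ^ 3 * 10 ^ (top13 - 5) by rewrite expnD mulnC.
have Xgt : 0 < 10 ^ (top13 - 5) by rewrite expn_gt0.
rewrite /least14 (@heightS_cons _ 8 (_ ++ _)) //; last by rewrite -cat_cons digits_cat digits_nines.
rewrite sumsq_cat sumsq_nines.
have -> : 8 * (8 * 8 + (sumsq [:: 5; 7; 8] + 81 * (top14 - 3)))
        = dval (8 :: [:: 3; 6] ++ nseq (top13 - 5) 9 ++ [:: 8; 8; 8]).
  rewrite (_ : sumsq [:: 5; 7; 8] = 138) //.
  have := dval_block888 [:: 8; 3; 6] (top13 - 5); rewrite XE.
  rewrite (_ : (dval [:: 8; 3; 6]).+1 = 837) //.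
  rewrite -[[:: 8; 3; 6] ++ _]/(8 :: [:: 3; 6] ++ _); lia.
rewrite (@heightS_cons _ 8 (_ ++ _)) //; last by rewrite -cat_cons !digits_cat digits_nines.
rewrite !sumsq_cat sumsq_nines.
have c12 : 8 * (8 * 8 + (sumsq [:: 3; 6] + (81 * (top13 - 5) + sumsq [:: 8; 8; 8])))
        = dval (8 :: nseq 6 9 ++ [:: 8; 8; 8]).
  have := dval_block888 [:: 8] 6; have -> : (dval [:: 8]).+1 = 9 by [].
  rewrite s36 s888 cat_cons cat0s; lia.
rewrite c12 (@heightS_cons 11 8 (nseq 6 9 ++ [:: 8; 8; 8]) isT isT isT).
rewrite sumsq_cat sumsq_nines s888.
by have := elated11_5936; congr (elated_of_height 11 _); lia.
Qed.

(** The slack 693 is [7 * (49 + 81 * (n + 3)) - 7 * (193 + 81 * n)]: a number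
    with leading digit 7 and as many digits as the least one of height 15 has an
    image at most this much above the least number of height 14. *)
Lemma least14_unique c : elated_of_height 14 c -> c <= least14 + 693 -> c = least14.
Proof.
move=> h le; have e14 := top14E; have m14 := top14_mod.
have nE := least14E; have n15 := nines15E.
have XE : 10 ^ (top14 - 3) = 10 * (10 ^ 7 * 10 ^ (top14 - 11)).
  by rewrite -expnD -expnS; congr (_ ^ _); lia.
have YE : 10 ^ (top14 - 4) = 10 ^ 7 * 10 ^ (top14 - 11).
  by rewrite -expnD; congr (_ ^ _); lia.
have ZE : 10 ^ top14.+1 = 10 ^ 4 * 10 ^ (top14 - 3).
  by rewrite -expnD; congr (_ ^ _); lia.
have X0 : 0 < 10 ^ (top14 - 11) by rewrite expn_gt0.
have [|s [sz ds rs cE]] := elated14_class h; first by lia.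
have sE : s = [:: 5; 7; 8; 9] ++ nseq (top14 - 4) 9.
  apply: (prefix_forced (d := 8) prefix_105 _ _ _ ds sz rs) => //; first by lia.
  by rewrite -cE YE; lia.
by rewrite cE sE /least14; have -> : top14 - 3 = (top14 - 4).+1 by lia.
Qed.

Lemma epsilon14E : epsilon 14 = least14.
Proof.
rewrite /epsilon; case: ex_minnP => m hm /(_ _ elated14_least14) le.
by apply: least14_unique => //; lia.
Qed.

(** * Height 15 *)

Definition least15 : nat := dval (7 :: [:: 4; 8; 8] ++ nseq nines15 9).

Lemma least15E : least15 + 1 = (7 * 10 ^ 3 + 489) * 10 ^ nines15.
Proof. exact: (dval_block9 [:: 7; 4; 8; 8] nines15). Qed.

Lemma elated15_least15 : elated_of_height 15 least15.
Proof.
rewrite /least15 (@heightS_cons _ 7 (_ ++ _)) //; last by rewrite -cat_cons digits_cat digits_nines.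
rewrite sumsq_cat sumsq_nines.
rewrite (_ : sumsq [:: 4; 8; 8] = 144) //.
by have := elated14_least14; rewrite least14E; congr (elated_of_height 14 _); lia.
Qed.

(** A number with one digit more has leading digit at most 6, which again makes
    its image too small; with one digit fewer, the deficit would be 18, not a
    sum of digit deficits. *)
Lemma elated15_class a : elated_of_height 15 a -> a < 7 * 10 ^ (nines15 + 4) ->
  exists s, [/\ size s = nines15 + 3, digits s, deficit s = 99 & a = dval (7 :: s)].
Proof.
move=> /heightS_dval[d [s [/andP[d0 d10] ds -> h]]] lt.
have e14 := top14E; have m14 := top14_mod; have sq := sumsqD ds.
have nE := least14E; have n15 := nines15E.
have XE : 10 ^ (top14 - 3) = 10 ^ 8 * 10 ^ (top14 - 11).
  by rewrite -expnD; congr (_ ^ _); lia.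
have ZE : 10 ^ top14 = 10 ^ 3 * 10 ^ (top14 - 3).
  by rewrite -expnD; congr (_ ^ _); lia.
have X0 : 0 < 10 ^ (top14 - 11) by rewrite expn_gt0.
have sz4 : size s <= nines15 + 4.
  by apply: (@size_le d) => //; apply: leq_trans lt _; rewrite expnS; lia.
have szd : size s <= nines15 + 3 \/ d <= 6.
  case: (leqP (size s) (nines15 + 3)) => [|gt]; [by left | right].
  have sE : size s = nines15 + 4 by lia.
  move: lt; rewrite dval_cons sE => /(leq_ltn_trans (leq_addr _ _)).
  by rewrite ltn_pmul2r ?expn_gt0.
have le6 : d <= 6 -> d * (d * d + sumsq s) <= 6 * (36 + 81 * (nines15 + 4)).
  by move=> d6; apply: leq_mul => //; have := leq_mul d6 d6; lia.
have le9 : size s <= nines15 + 3 ->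
    d * (d * d + sumsq s) <= 9 * (81 + 81 * (nines15 + 3)).
  move=> sz; have d9 : d <= 9 by []; apply: leq_mul => //.
  by have := leq_mul d9 d9; lia.
have ge13 := @classified_ge _ _ _ _ elated13_class.
have [|||inC d9] := image_in_class (S := d * d + sumsq s) (d := d) elated14_class _ ge13 _ h erefl.
- by vm_compute.
- have YE : 10 ^ top13 = 10 ^ 5 * 10 ^ (top13 - 5).
    by rewrite -expnD; congr (_ ^ _); have := top13E; lia.
  by have : 0 < 10 ^ (top13 - 5); [rewrite expn_gt0 | lia].
- by rewrite expnS ZE; case: szd => [/le9|/le6]; lia.
have d6 : 6 < d.
  by rewrite ltnNge; apply/negP => /le6; have := class_ge inC; rewrite ZE; lia.
have d8 : d <> 8.
  have t3 : 3 <= top14 by lia.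
  by move=> d8; have := class_105_ndvd8 t3 inC; rewrite d8 dvdn_mulr.
have d7 : d = 7 by lia.
have sz3 : size s <= nines15 + 3 by lia.
rewrite d7 in h lt *.
have := least14_unique h ltac:(lia); rewrite nE => /eqP.
rewrite eqn_pmul2l // => /eqP e.
have e18 := @unreachable s 18 erefl ds.
by exists s; split=> //; lia.
Qed.

Lemma epsilon15E : epsilon 15 = least15.
Proof.
rewrite /epsilon; case: ex_minnP => m hm /(_ _ elated15_least15) le.
have nE := least15E; have X0 : 0 < 10 ^ nines15 by rewrite expn_gt0.
have [|s [sz ds rs mE]] := elated15_class hm.
  by rewrite expnD; lia.
have sE : s = [:: 4; 8; 8] ++ nseq (nines15 + 3 - 3) 9.
  apply: (prefix_forced (d := 7) prefix_99 _ _ _ ds sz rs) => //; first exact: leq_addl.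
  by rewrite -mE addnK; lia.
by rewrite mE sE addnK.
Qed.

(** Sorted words have all later digits at least as large as the third one, which
    restricts the deficits that can remain after the first three digits. *)
Definition sorted_99_forces_488 : bool :=
  all (fun w => if (deficit w <= 99) && (sorted leq w && (nth 0 w 0 <= 4))
                then (residues (nth 0 w 2) (99 - deficit w) != [::]) ==> (w == [:: 4; 8; 8])
                else true) (words 3).

Lemma sorted_99P : sorted_99_forces_488.
Proof. by vm_compute. Qed.

(** Without a digit below 5 the deficit 99 cannot be reached; hence a sorted
    word of deficit 99 begins with a digit at most 4. *)
Lemma residues5_99 : residues 5 99 = [::].
Proof. by vm_compute. Qed.

Lemma sorted_deficit_99 n s : digits s -> sorted leq s -> size s = n + 3 ->
  deficit s = 99 -> s = [:: 4; 8; 8] ++ nseq n 9.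
Proof.
move=> ds srt sz rs; have [|w [t [v [sE szw szt szv]]]] := @split3 s 3 n 0; first by lia.
case: v szv sE => // _; rewrite cats0 => sE.
have y4 : nth 0 s 0 <= 4.
  rewrite leqNgt; apply/negP => y5.
  apply: (unreachable_ge residues5_99 ds _ rs).
  apply/(all_nthP 0) => i lt; apply: leq_trans y5 _.
  by apply: (sorted_leq_nth leq_trans leqnn 0 srt); rewrite ?inE; lia.
have ge3 : all (leq (nth 0 s 2)) t.
  apply/(all_nthP 0) => i lt.
  have -> : nth 0 t i = nth 0 s (3 + i) by rewrite sE nth_cat szw /= addKn.
  by apply: (sorted_leq_nth leq_trans leqnn 0 srt); rewrite ?inE; lia.
have nthE i : i < 3 -> nth 0 s i = nth 0 w i by move=> lt; rewrite sE nth_cat szw lt.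
rewrite !nthE // in y4 ge3.
move: ds rs srt; rewrite sE digits_cat deficit_cat => /andP[dw dt] rs /cat_sorted2[sw _].
have := allP sorted_99P w (mem_words_size dw szw).
have -> : deficit w <= 99 by lia.
rewrite sw y4 /=; have := residuesP (digits_ge dt ge3).
have -> : 99 - deficit w = deficit t by lia.
case: (residues _ _) => //= _ _ _ /eqP wE.
rewrite wE in rs *; rewrite (deficit0 dt) ?szt //.
have : deficit [:: 4; 8; 8] = 99 by [].
lia.
Qed.

Lemma basic_least15 : basic least15.
Proof.
have nE := least15E; have X0 : 0 < 10 ^ nines15 by rewrite expn_gt0.
apply/basic_dval => //; first by rewrite -cat_cons digits_cat digits_nines.
split; first by rewrite -/least15; lia.
- by rewrite all_cat all_nseq orbT.
- by rewrite /= path_min_sorted ?all_nseq ?orbT //; elim: nines15 => [|[|n]].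
Qed.

Theorem theorem22 :
  exists n15 : nat,
    [/\ (n15%:R = ((epsilon 14)%:R / 7 - 7 ^+ 2 - 144) / 9 ^+ 2 :> rat)%R,
        epsilon 15 = 7489 * 10 ^ n15 - 1
      & forall a : nat,
          [/\ basic a, elated_of_height 15 a & a < 7 * 10 ^ (n15 + 4)]
          <-> a = epsilon 15].
Proof.
exists nines15; rewrite epsilon14E epsilon15E; split.
- by rewrite least14E natrM natrD natrM; lra.
- have -> : 7489 = 7 * 10 ^ 3 + 489 by [].
  by rewrite -least15E addnK.
move=> a; split=> [[bas h lt] | ->].
  have [s [sz ds rs aE]] := elated15_class h lt.
  move: bas; rewrite aE => /basic_dval[] // _ _ srt.
  by rewrite (sorted_deficit_99 ds srt sz rs).
split; [exact: basic_least15 | exact: elated15_least15 | ].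
have nE := least15E; have X0 : 0 < 10 ^ nines15 by rewrite expn_gt0.
by rewrite expnD; lia.
Qed.
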